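(* The Riemannian metric on $\mathrm{SpSt}(2n,2k)$ for which $\pi:(\mathrm{Sp}(2n,\mathbb{R}),g)\to\mathrm{SpSt}(2n,2k)$ is a Riemannian submersion is right-invariant (i.e. invariant under the action $U\mapsto UN$ of $N\in\mathrm{Sp}(2k,\mathbb{R})$) and is given point-wise, for $U=\pi(M)$ and $\Delta_1,\Delta_2\in T_U\mathrm{SpSt}(2n,2k)$, by $$g^{\mathrm{SpSt}}_U(\Delta_1,\Delta_2):=g_M\big((\Delta_1)^{\mathrm{hor},g}_M,(\Delta_2)^{\mathrm{hor},g}_M\big)=\mathrm{tr}\left(\Delta_1^T\left(I_{2n}-\tfrac12J_{2n}^TU(U^TU)^{-1}U^TJ_{2n}\right)\Delta_2(U^TU)^{-1}\right).$$
   Context: Let $k\le n$ be positive integers, $J_{2m}=\begin{bmatrix}0&I_m\\-I_m&0\end{bmatrix}$, and for a real $2a\times 2b$ matrix $A$ put $A^+:=J_{2b}^TA^TJ_{2a}$ (symplectic inverse). $\mathrm{Sp}(2n,\mathbb{R})=\{M\in\mathbb{R}^{2n\times 2n}: M^+M=I_{2n}\}$, with Lie algebra $\mathfrak{sp}(2n,\mathbb{R})=\{\Omega:\Omega^+=-\Omega\}$. $\mathrm{SpSt}(2n,2k)=\{U\in\mathbb{R}^{2n\times2k}:U^+U=I_{2k}\}$, with tangent spaces $T_U\mathrm{SpSt}(2n,2k)=\{\Delta\in\mathbb{R}^{2n\times2k}: U^+\Delta\in\mathfrak{sp}(2k,\mathbb{R})\}$. Let $I_{n,k}=\begin{bmatrix}I_k\\0\end{bmatrix}\in\mathbb{R}^{n\times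 k}$, $E=\begin{bmatrix}I_{n,k}&0\\0&I_{n,k}\end{bmatrix}\in\mathbb{R}^{2n\times2k}$, and $\pi:\mathrm{Sp}(2n,\mathbb{R})\to\mathrm{SpSt}(2n,2k)$, $\pi(M)=ME$. $\mathrm{Sp}(2n,\mathbb{R})$ carries the right-invariant Riemannian metric $g_M(X_1,X_2)=\frac12\mathrm{tr}\big((X_1M^+)^TX_2M^+\big)$. For $\Delta\in T_{\pi(M)}\mathrm{SpSt}(2n,2k)$, $\Delta^{\mathrm{hor},g}_M$ is the horizontal lift: the unique element of the $g_M$-orthogonal complement of $\ker \mathrm{d}\pi_M$ in $T_M\mathrm{Sp}(2n,\mathbb{R})$ that $\mathrm{d}\pi_M$ maps to $\Delta$. *)

(* Defs.v *)
From HB Require Import structures.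
From mathcomp Require Import all_boot all_order all_algebra.
From mathcomp Require Import all_classical all_reals all_analysis.

Set Implicit Arguments.
Unset Strict Implicit.
Unset Printing Implicit Defensive.

Import Order.TTheory GRing.Theory Num.Theory.
Import numFieldNormedType.Exports.

Local Open Scope classical_set_scope.
Local Open Scope ring_scope.

(* On a finite-dimensional V, [C_on r O f] is the usual notion of a map of
   class C^r on the open set O: the iterated directional derivatives of f up
   to order r exist and are continuous on O. *)
Fixpoint C_on {R : realType} {V W : normedModType R} (r : nat) (O : set V)
    (f : V -> W) : Prop :=
  (forall x, O x -> {for x, continuous f}) /\
  match r with
  | 0%N => True
  | r'.+1 => forall v : V,
      (forall x, O x -> derivable f x v) /\ C_on r' O (fun x : V => 'D_v f x)
  end.

(* A map on an embedded submanifold S of V is smooth when, near each point of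
   S, it is the restriction of a C^oo map on an open subset of V; the values
   of f outside S are irrelevant. *)
Definition smooth_on {R : realType} {V W : normedModType R} (S : set V)
    (f : V -> W) : Prop :=
  forall x, S x -> exists (O : set V) (F : V -> W),
    [/\ open O, O x, forall r, C_on r O F &
        forall y, O y -> S y -> F y = f y].

(* S is an embedded submanifold of V with tangent spaces T x, for x in S.  The
   form h x is relevant only for x in S and arguments in T x.  Smoothness is
   tested against smooth tangent vector fields. *)
Definition riemannian_metric {R : realType} {V : normedModType R}
    (S : set V) (T : V -> set V) (h : V -> V -> V -> R) : Prop :=
  [/\ forall x, S x -> forall (a : R) (u v w : V), T x u -> T x v -> T x w ->
        h x (a *: u + v) w = a * h x u w + h x v w,
      forall x, S x -> forall u v, T x u -> T x v -> h x u v = h x v u,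
      forall x, S x -> forall u, T x u -> u != 0 -> 0 < h x u u &
      forall X Y : V -> V,
        (forall x, S x -> T x (X x)) -> (forall x, S x -> T x (Y x)) ->
        smooth_on S X -> smooth_on S Y ->
        smooth_on S (fun x => h x (X x) (Y x) : R)].

(* The vectors of T x orthogonal to the kernel of the differential of f
   restricted to T x; f is given on the ambient space. *)
Definition horizontal {R : realType} {V W : normedModType R} (T : V -> set V)
    (g : V -> V -> V -> R) (f : V -> W) (x : V) : set V :=
  [set X | T x X /\ forall Y, T x Y -> 'd f x Y = 0 -> g x X Y = 0].

(* The horizontal vector mapped to D by the differential (0 if none exists). *)
Definition hor_lift {R : realType} {V W : normedModType R} (T : V -> set V)
    (g : V -> V -> V -> R) (f : V -> W) (x : V) (D : W) : V :=
  xget 0 [set X | horizontal T g f x X /\ 'd f x X = D].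

Definition riemannian_submersion {R : realType} {V W : normedModType R}
    (S : set V) (T : V -> set V) (g : V -> V -> V -> R)
    (S' : set W) (T' : W -> set W) (h : W -> W -> W -> R)
    (f : V -> W) : Prop :=
  [/\ f @` S = S',
      smooth_on S f /\ (forall x, S x -> differentiable f x),
      forall x, S x -> 'd f x @` T x = T' (f x) &
      forall x, S x -> forall X Y, horizontal T g f x X ->
        horizontal T g f x Y -> h (f x) ('d f x X) ('d f x Y) = g x X Y].

Definition Jmx {R : realType} (m : nat) : 'M[R]_(m + m) :=
  block_mx 0 1%:M (- 1%:M) 0.

Definition sinv {R : realType} {a b : nat} (A : 'M[R]_(a + a, b + b)) :
    'M[R]_(b + b, a + a) :=
  (Jmx b)^T *m A^T *m Jmx a.

Definition Sp (R : realType) (n : nat) : set 'M[R]_(n + n) :=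
  [set M | sinv M *m M = 1%:M].

Definition sp (R : realType) (n : nat) : set 'M[R]_(n + n) :=
  [set X | sinv X = - X].

Definition SpSt (R : realType) (n k : nat) : set 'M[R]_(n + n, k + k) :=
  [set U | sinv U *m U = 1%:M].

Definition tangent_SpSt {R : realType} {n k : nat} (U : 'M[R]_(n + n, k + k)) :
    set 'M[R]_(n + n, k + k) :=
  [set D | sp (sinv U *m D)].

Definition tangent_Sp {R : realType} {n : nat} (M : 'M[R]_(n + n)) :
    set 'M[R]_(n + n) :=
  [set X | sp (sinv M *m X)].

(* [pid_mx k : 'M_(n, k)] is I_k stacked on top of a zero block (k <= n). *)
Definition Emx {R : realType} (n k : nat) : 'M[R]_(n + n, k + k) :=
  block_mx (pid_mx k : 'M[R]_(n, k)) 0 0 (pid_mx k : 'M[R]_(n, k)).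

Definition piSpSt {R : realType} (n k : nat) (M : 'M[R]_(n + n)) :
    'M[R]_(n + n, k + k) :=
  M *m Emx n k.

Definition gSp {R : realType} {n : nat} (M X1 X2 : 'M[R]_(n + n)) : R :=
  2^-1 * \tr ((X1 *m sinv M)^T *m (X2 *m sinv M)).

Definition hor_lift_Sp {R : realType} {n k : nat} (M : 'M[R]_(n + n))
    (D : 'M[R]_(n + n, k + k)) : 'M[R]_(n + n) :=
  hor_lift tangent_Sp gSp (@piSpSt R n k) M D.

Definition right_invariant {R : realType} {n k : nat}
    (h : 'M[R]_(n + n, k + k) -> 'M[R]_(n + n, k + k) ->
         'M[R]_(n + n, k + k) -> R) : Prop :=
  forall (N : 'M[R]_(k + k)) (U D1 D2 : 'M[R]_(n + n, k + k)),
    Sp N -> SpSt U -> tangent_SpSt U D1 -> tangent_SpSt U D2 ->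
    let act := fun U' : 'M[R]_(n + n, k + k) => U' *m N in
    h (act U) ('d act U D1) ('d act U D2) = h U D1 D2.

(* Main.v *)
Require Import Defs.
From HB Require Import structures.
From mathcomp Require Import all_boot all_order all_algebra.
From mathcomp Require Import all_classical all_reals all_analysis.

Import Order.TTheory GRing.Theory Num.Theory.
Import numFieldNormedType.Exports.

(** Write a tangent vector of the symplectic group at [M] as [X = J S M] with
    [S] symmetric ([tangent_SpP]).  Since [J] is orthogonal, the right-invariant
    metric is then half the Frobenius product of the symmetric matrices
    ([gSpE]), and with [U = M E] the differential of the projection is
    [X |-> X E = J S U].  So for a tangent vector [D] at [U], everything takes
    place among the symmetric solutions [S] of [S U = W], where [W = J^T D];
    tangency of [D] says that [U^T W] is symmetric.

    Let [G] be the inverse of the Gram matrix [U^T U] and [P = U G U^T] the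
    orthogonal projector onto the columns of [U].  The symmetric matrices with
    [S U = 0] are those of the form [(1 - P) S' (1 - P)], so the solution
    orthogonal to all of them is the one with [(1 - P) S (1 - P) = 0], namely
    [sym_lift U W = W G U^T + U G W^T (1 - P)].  This gives existence of the
    horizontal lift; it is unique because the metric on the symplectic group is
    positive definite ([horizontal_inj]).  Expanding half the Frobenius product
    of two such matrices yields [tr (W1^T (1 - P/2) W2 G)]
    ([mxtrace_sym_lift]), which is the announced formula once [J] is moved
    through.  The formula depends on [M] only through [U], and replacing
    [(U, D)] by [(U N, D N)] leaves [P] fixed and turns [G] into
    [N^-1 G N^-T], so that [N] cancels: this is right invariance.

    The formula determines every metric making the projection a Riemannian
    submersion, because the projection is onto: a symplectic frame of [k] pairs
    is completed to a symplectic basis one pair at a time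
    ([symplectic_frame_completion]).  Conversely the formula does define such a
    metric.  It is positive definite because it is a Frobenius square and
    [sym_lift U W] determines [W]; it is smooth because it is built from the
    entries of its arguments by ring operations and the inversion of a
    determinant, all of which preserve the class [C_on r] for every [r]. *)

Set Implicit Arguments.
Unset Strict Implicit.
Unset Printing Implicit Defensive.

Local Open Scope classical_set_scope.
Local Open Scope ring_scope.

(** * Smooth maps on open sets *)

Section Smooth.
Context {R : realType} {V : normedModType R}.
Implicit Types (O : set V) (r : nat).

Lemma C_on_continuous {W : normedModType R} r O (f : V -> W) x :
  C_on r O f -> O x -> {for x, continuous f}.
Proof. by case: r => [|r] [fc _]; exact: fc. Qed.

(** Openness of [O] is what makes this true: derivatives at a point of [O] only
    see the values of the function near that point. *)
Lemma C_on_eq {W : normedModType R} r O (f g : V -> W) : open O ->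
  (forall x, O x -> f x = g x) -> C_on r O f -> C_on r O g.
Proof.
move=> oO; have near_on (h h' : V -> W) x : (forall y, O y -> h y = h' y) ->
    O x -> \forall y \near x, h y = h' y.
  by move=> hh' Ox; exact: filterS hh' (open_nbhs_nbhs (conj oO Ox)).
have cont_on (h h' : V -> W) x : (forall y, O y -> h y = h' y) -> O x ->
    {for x, continuous h} -> {for x, continuous h'}.
  move=> hh' Ox hc.
  suff : h' y @[y --> x] --> h' x by [].
  rewrite -hh' //; apply: cvg_trans hc; apply: near_eq_cvg.
  exact: near_on.
elim: r f g => [|r IH] f g fg [fc fd]; split=> //;
  try by move=> x Ox; exact: cont_on fg Ox (fc x Ox).
move=> v; have [fdv Cv] := fd v; split.
  by move=> x Ox; apply: near_eq_derivable (near_on _ _ _ fg Ox) (fdv x Ox).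
by apply: IH Cv => x Ox; apply: near_eq_derive; exact: near_on.
Qed.

Lemma C_on_subset {W : normedModType R} r O O' (f : V -> W) :
  O' `<=` O -> C_on r O f -> C_on r O' f.
Proof.
move=> sO; elim: r f => [|r IH] f [fc fd]; split=> //.
- by move=> x /sO; exact: fc.
- by move=> x /sO; exact: fc.
- move=> v; have [fdv Cv] := fd v; split; last exact: IH.
  by move=> x /sO; exact: fdv.
Qed.

Lemma C_onW {W : normedModType R} r O (f : V -> W) :
  C_on r.+1 O f -> C_on r O f.
Proof.
elim: r f => [|r IH] f [fc fd]; split=> // v.
by have [fdv Cv] := fd v; split=> //; exact: IH.
Qed.

Lemma C_on_cst {W : normedModType R} r O (c : W) : C_on r O (cst c).
Proof.
elim: r c => [|r IH] c; split=> //; try by move=> x _; exact: cvg_cst.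
move=> v; split; first by move=> x _; exact: derivable_cst.
rewrite (_ : (fun x => _) = cst 0); first exact: IH.
by apply/funext => x; rewrite derive_cst.
Qed.

Lemma C_on_linear {W : normedModType R} r O (f : {linear V -> W}) :
  continuous f -> C_on r O f.
Proof.
move=> fc; have fD x v : 'D_v f x = f v.
  by rewrite deriveE ?diff_lin//; exact: linear_differentiable.
case: r => [|r]; split=> //; try by move=> x _; exact: fc.
move=> v; split.
  by move=> x _; apply: diff_derivable; exact: linear_differentiable.
by rewrite (funext (fD ^~ v)); exact: C_on_cst.
Qed.

Lemma C_on_coord {m n : nat} r O (f : V -> 'M[R]_(m, n)) i j :
  open O -> C_on r O f -> C_on r O (fun x => f x i j : R).
Proof.
move=> oO; have cont (g : V -> 'M[R]_(m, n)) x :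
    {for x, continuous g} -> {for x, continuous (fun x => g x i j : R)}.
  move=> gc; apply: (@continuous_comp _ _ _ g (fun A : 'M[R]_(m, n) => A i j)).
    exact: gc.
  exact: coord_continuous.
elim: r f => [|r IH] f [fc fd]; split=> //; try by move=> x /fc; exact: cont.
move=> v; have [fdv Cv] := fd v; split.
  by move=> x /fdv /derivable_mxP; apply.
apply: C_on_eq (IH _ Cv) => // x /fdv fx.
by rewrite derive_mx // mxE.
Qed.

Lemma C_onD {W : normedModType R} r O (f g : V -> W) : open O ->
  C_on r O f -> C_on r O g -> C_on r O (fun x => f x + g x).
Proof.
move=> oO; elim: r f g => [|r IH] f g [fc fd] [gc gd]; split=> //;
  try by move=> x Ox; apply: cvgD; [exact: fc|exact: gc].
move=> v; have [fdv Cf] := fd v; have [gdv Cg] := gd v; split.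
  by move=> x Ox; apply: derivableD; [exact: fdv|exact: gdv].
apply: C_on_eq (IH _ _ Cf Cg) => // x Ox.
by rewrite -[RHS]/('D_v (f + g) x) deriveD //; [exact: fdv|exact: gdv].
Qed.

(** The Leibniz rule expresses the derivative by products of functions of class
    [C^r], one of them being [f] or [g] itself; hence the appeal to [C_onW]. *)
Lemma C_onM r O (f g : V -> R) : open O ->
  C_on r O f -> C_on r O g -> C_on r O (fun x => f x * g x).
Proof.
move=> oO; elim: r f g => [|r IH] f g fC gC.
  by split=> // x Ox; apply: cvgM; [exact: fC.1|exact: gC.1].
split; first by move=> x Ox; apply: cvgM; [exact: fC.1|exact: gC.1].
move=> v; have [fdv Cf] := fC.2 v; have [gdv Cg] := gC.2 v; split.
  by move=> x Ox; apply: derivableM; [exact: fdv|exact: gdv].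
have fDg : C_on r O (fun x => f x * 'D_v g x) by apply: IH; [exact: C_onW|].
have gDf : C_on r O (fun x => g x * 'D_v f x) by apply: IH; [exact: C_onW|].
suff : C_on r O ('D_v (fun x => f x * g x)) by [].
apply: C_on_eq (C_onD oO fDg gDf) => // x Ox.
by rewrite -[RHS]/('D_v (f * g) x) deriveM //; [exact: fdv|exact: gdv].
Qed.

(** Induction through [(1/f)' = - (1/f) (1/f) f'], whose right-hand side is of
    class [C^r] by the induction hypothesis. *)
Lemma C_onV r O (f : V -> R) : open O -> (forall x, O x -> f x != 0) ->
  C_on r O f -> C_on r O (fun x => (f x)^-1).
Proof.
move=> oO f0; elim: r => [|r IH] fC.
  by split=> // x Ox; apply: cvgV; [exact: f0|exact: fC.1].
split; first by move=> x Ox; apply: cvgV; [exact: f0|exact: fC.1].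
move=> v; have [fdv Cf] := fC.2 v; split.
  by move=> x Ox; apply: derivableV; [exact: f0|exact: fdv].
have fVC := IH (C_onW fC).
have Dfv : C_on r O (fun x => -1 * ((f x)^-1 * (f x)^-1 * 'D_v f x)).
  by apply: C_onM => //; [exact: C_on_cst|do !apply: C_onM].
suff : C_on r O ('D_v (fun x => (f x)^-1)) by [].
apply: C_on_eq Dfv => // x Ox.
rewrite deriveV; [|exact: f0|exact: fdv].
by rewrite /cst mulN1r -mulNr -expr2 exprVn.
Qed.

Lemma C_on_sum r O (I : Type) (s : seq I) (P : pred I) (F : I -> V -> R) :
  open O -> (forall i, P i -> C_on r O (F i)) ->
  C_on r O (fun x => \sum_(i <- s | P i) F i x).
Proof.
move=> oO FC; elim: s => [|i s IH].
  by under eq_fun do rewrite big_nil; exact: C_on_cst.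
under eq_fun do rewrite big_cons.
by case Pi: (P i) => //; apply: C_onD => //; exact: FC.
Qed.

Lemma C_on_prod r O (I : Type) (s : seq I) (P : pred I) (F : I -> V -> R) :
  open O -> (forall i, P i -> C_on r O (F i)) ->
  C_on r O (fun x => \prod_(i <- s | P i) F i x).
Proof.
move=> oO FC; elim: s => [|i s IH].
  by under eq_fun do rewrite big_nil; exact: C_on_cst.
under eq_fun do rewrite big_cons.
by case Pi: (P i) => //; apply: C_onM => //; exact: FC.
Qed.

End Smooth.

Section SmoothMatrix.
Context {R : realType} {V : normedModType R} (r : nat) (O : set V) (oO : open O).

(** Smoothness of matrix-valued maps is handled entrywise, so that only the
    calculus of scalar functions is needed. *)
Definition entries_C_on {m n : nat} (f : V -> 'M[R]_(m, n)) : Prop :=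
  forall i j, C_on r O (fun x => f x i j : R).

Lemma entries_C_on_cst {m n} (A : 'M[R]_(m, n)) : entries_C_on (fun=> A).
Proof. by move=> i j; exact: C_on_cst. Qed.

Lemma entries_C_on_tr {m n} (f : V -> 'M[R]_(m, n)) :
  entries_C_on f -> entries_C_on (fun x => (f x)^T).
Proof. by move=> fC i j; under eq_fun do rewrite mxE; exact: fC. Qed.

Lemma entries_C_onD {m n} (f g : V -> 'M[R]_(m, n)) :
  entries_C_on f -> entries_C_on g -> entries_C_on (fun x => f x + g x).
Proof.
by move=> fC gC i j; under eq_fun do rewrite mxE; exact: C_onD.
Qed.

Lemma entries_C_onZ {m n} (a : V -> R) (f : V -> 'M[R]_(m, n)) :
  C_on r O a -> entries_C_on f -> entries_C_on (fun x => a x *: f x).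
Proof.
by move=> aC fC i j; under eq_fun do rewrite mxE; exact: C_onM.
Qed.

Lemma entries_C_onM {m n p} (f : V -> 'M[R]_(m, n)) (g : V -> 'M[R]_(n, p)) :
  entries_C_on f -> entries_C_on g -> entries_C_on (fun x => f x *m g x).
Proof.
move=> fC gC i j; under eq_fun do rewrite mxE.
by apply: C_on_sum => // l _; exact: C_onM.
Qed.

Lemma C_on_mxtrace {n} (f : V -> 'M[R]_n) :
  entries_C_on f -> C_on r O (fun x => \tr (f x)).
Proof. by move=> fC; apply: C_on_sum => // i _; exact: fC. Qed.

Lemma C_on_det {n} (f : V -> 'M[R]_n) :
  entries_C_on f -> C_on r O (fun x => \det (f x)).
Proof.
move=> fC; rewrite /determinant; apply: C_on_sum => // s _.
by apply: C_onM => //; [exact: C_on_cst|apply: C_on_prod].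
Qed.

(** Cramer's rule: the entries of the inverse are cofactors divided by the
    determinant, hence rational functions of the entries. *)
Lemma entries_C_onV {n} (f : V -> 'M[R]_n) :
  (forall x, O x -> f x \in unitmx) ->
  entries_C_on f -> entries_C_on (fun x => invmx (f x)).
Proof.
move=> fu fC i j.
have adjC : C_on r O (fun x => (\det (f x))^-1 * \adj (f x) i j).
  apply: C_onM => //; first apply: C_onV => //.
  - by move=> x /fu; rewrite unitmxE unitfE.
  - exact: C_on_det.
  under eq_fun do rewrite mxE.
  apply: C_onM => //; first exact: C_on_cst.
  by apply: C_on_det => i' j'; under eq_fun do rewrite !mxE; exact: fC.
by apply: C_on_eq adjC => // x /fu fx; rewrite /invmx fx !mxE.
Qed.

End SmoothMatrix.

(** A linear map on matrices is a finite combination of the coordinates. *)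
Lemma linear_mx_continuous {R : realType} {m n} {W : normedModType R}
  (f : {linear 'M[R]_(m, n) -> W}) : continuous f.
Proof.
have -> : (f : 'M[R]_(m, n) -> W) =
    (fun A => \sum_i \sum_j A i j *: f (delta_mx i j)).
  apply/funext => A; rewrite {1}[A]matrix_sum_delta linear_sum.
  apply: eq_bigr => i _; rewrite linear_sum; apply: eq_bigr => j _.
  by rewrite linearZ.
have addWc : continuous (fun x : W * W => x.1 + x.2) by exact: add_continuous.
apply: (continuous_big addWc) => i _.
apply: (continuous_big addWc) => j _ A.
exact: (@cvgZr_tmp R W _ (nbhs A) _ (fun A' : 'M[R]_(m, n) => A' i j) _ _
  (@coord_continuous _ _ _ i j A)).
Qed.

(** * Matrix preliminaries *)

Lemma tr_congruence {R : comPzRingType} {m n} (S : 'M[R]_m) (A : 'M[R]_(m, n)) :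
  S^T = S -> (A^T *m S *m A)^T = A^T *m S *m A.
Proof. by move=> symS; rewrite !trmx_mul trmxK symS mulmxA. Qed.

Lemma invmx_mul {R : comUnitRingType} {n} (A B : 'M[R]_n) :
  A \in unitmx -> B \in unitmx ->
  invmx (A *m B) = invmx B *m invmx A.
Proof.
move=> uA uB; have uAB : A *m B \in unitmx by rewrite unitmx_mul uA.
by rewrite -[RHS](mulmxK uAB) mulmxA mulmxKV // mulVmx // mul1mx.
Qed.

Section Gram.
Context {R : realFieldType}.

Lemma mxtrace_gram {m n} (A : 'M[R]_(m, n)) :
  \tr (A^T *m A) = \sum_i \sum_j A j i ^+ 2.
Proof.
apply: eq_bigr => i _; rewrite mxE.
by apply: eq_bigr => j _; rewrite mxE expr2.
Qed.

Lemma mxtrace_gram_ge0 {m n} (A : 'M[R]_(m, n)) : 0 <= \tr (A^T *m A).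
Proof.
by rewrite mxtrace_gram; do 2!apply: sumr_ge0 => ? _; exact: sqr_ge0.
Qed.

Lemma mxtrace_gram_eq0 {m n} (A : 'M[R]_(m, n)) :
  \tr (A^T *m A) = 0 -> A = 0.
Proof.
rewrite mxtrace_gram => /eqP; rewrite psumr_eq0 => [|i _]; last first.
  by apply: sumr_ge0 => ? _; exact: sqr_ge0.
move=> /allP A0; apply/matrixP => i j; rewrite mxE.
have := A0 j (mem_index_enum _); rewrite psumr_eq0 => [|? _]; last exact: sqr_ge0.
by move=> /allP /(_ i (mem_index_enum _)); rewrite /= sqrf_eq0 => /eqP.
Qed.

(** A left inverse makes [U] injective, and [U^T U x = 0] forces [|U x|^2 = 0].
    For [U] in the symplectic Stiefel manifold, the symplectic inverse is such
    a left inverse. *)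
Lemma gram_unitmx {m n} (L : 'M[R]_(n, m)) (U : 'M[R]_(m, n)) :
  L *m U = 1%:M -> U^T *m U \in unitmx.
Proof.
move=> LU; rewrite -row_free_unit -kermx_eq0; apply/eqP.
set K := kermx _; have KU0 : K *m U^T *m U = 0 by rewrite -mulmxA mulmx_ker.
have UK0 : U *m K^T = 0.
  apply: mxtrace_gram_eq0.
  by rewrite trmx_mul trmxK mulmxA KU0 mul0mx linear0.
by rewrite -[K]trmxK -[K^T]mul1mx -LU -mulmxA UK0 mulmx0 trmx0.
Qed.

End Gram.

(** * The symplectic form and its frames *)

Section Symplectic.
Context {R : realType}.
Local Notation J n := (@Jmx R n).

Lemma trJmx n : (J n)^T = - J n.
Proof.
by rewrite /Jmx tr_block_mx !trmx0 linearN /= trmx1 opp_block_mx !oppr0 opprK.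
Qed.

Lemma JmxJ n : J n *m J n = - 1%:M.
Proof.
rewrite /Jmx mulmx_block !mul0mx !mulmx0 !add0r !addr0 mulmx1 mul1mx.
by rewrite [in RHS](@scalar_mx_block _ n n) opp_block_mx !oppr0.
Qed.

Lemma mul_trJ_J n : (J n)^T *m J n = 1%:M.
Proof. by rewrite trJmx mulNmx JmxJ opprK. Qed.

Lemma mul_J_trJ n : J n *m (J n)^T = 1%:M.
Proof. by rewrite trJmx mulmxN JmxJ opprK. Qed.

Lemma SpStP n k (U : 'M[R]_(n + n, k + k)) :
  SpSt U <-> U^T *m J n *m U = J k.
Proof.
rewrite /SpSt /sinv /=; split=> [sU|UJU].
  by rewrite -[RHS]mulmx1 -sU !mulmxA mul_J_trJ mul1mx.
by rewrite -2!mulmxA [U^T *m _]mulmxA UJU mul_trJ_J.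
Qed.

(** With [Omega = J^T S], the condition [Omega^+ = - Omega] reads [S^T = S]; here
    [S] is [U^T J D]. *)
Lemma tangent_SpStP n k (U D : 'M[R]_(n + n, k + k)) :
  tangent_SpSt U D <-> (U^T *m J n *m D)^T = U^T *m J n *m D.
Proof.
rewrite /tangent_SpSt /sp /sinv /=.
have -> : (J k)^T *m ((J k)^T *m U^T *m J n *m D)^T *m J k =
          - ((J k)^T *m (U^T *m J n *m D)^T).
  rewrite -!mulmxA trmx_mul trmxK -!mulmxA JmxJ.
  by rewrite !mulmxN mulmx1.
rewrite -!mulmxA; split=> [|-> //].
by move=> /oppr_inj /(congr1 (mulmx (J k))); rewrite !mulmxA mul_J_trJ !mul1mx.
Qed.

Lemma SpSt_gram n k (U : 'M[R]_(n + n, k + k)) :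
  SpSt U -> U^T *m U \in unitmx.
Proof. exact: gram_unitmx. Qed.

Lemma Sp_mulmx_sinv n (M : 'M[R]_(n + n)) : Sp M -> M *m sinv M = 1%:M.
Proof. by move=> /mulmx1C. Qed.

Lemma mul_SpSt n l k (U : 'M[R]_(n + n, l + l)) (V : 'M[R]_(l + l, k + k)) :
  SpSt U -> SpSt V -> SpSt (U *m V).
Proof.
move=> /SpStP UJU /SpStP VJV; apply/SpStP.
by rewrite trmx_mul -!mulmxA [U^T *m _]mulmxA [_ *m (U *m V)]mulmxA UJU mulmxA.
Qed.

Lemma Emx_SpSt n k : (k <= n)%N -> SpSt (@Emx R n k).
Proof.
move=> kn; apply/SpStP; rewrite /Emx /Jmx tr_block_mx !trmx0 !tr_pid_mx.
rewrite !mulmx_block !(mulmx0, mul0mx, add0r, addr0, mulmx1, mulmxN, mulNmx).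
by rewrite mul_pid_mx minnn (minn_idPr kn) pid_mx_1.
Qed.

(** The two blocks of columns are kept apart because extending a frame adds one
    column to each of them. *)
Definition symplectic_frame n k (A B : 'M[R]_(n + n, k)) : Prop :=
  [/\ A^T *m J n *m A = 0, B^T *m J n *m B = 0 & A^T *m J n *m B = 1%:M].

Lemma symplectic_swap n k l (A : 'M[R]_(n + n, k)) (B : 'M[R]_(n + n, l)) :
  (A^T *m J n *m B)^T = - (B^T *m J n *m A).
Proof. by rewrite !trmx_mul trmxK trJmx mulNmx mulmxN mulmxA. Qed.

Lemma symplectic_frameP n k (A B : 'M[R]_(n + n, k)) :
  symplectic_frame A B <-> SpSt (row_mx A B).
Proof.
have BA : B^T *m J n *m A = - (A^T *m J n *m B)^T.
  by rewrite symplectic_swap opprK.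
rewrite SpStP tr_row_mx mul_col_mx mul_col_row BA [J k]/Jmx; split.
  by case=> -> -> ->; rewrite trmx1.
by move=> /eq_block_mx [AA AB _ BB]; split.
Qed.

Lemma symplectic_col_isotropic n (x : 'cV[R]_(n + n)) : x^T *m J n *m x = 0.
Proof.
have := symplectic_swap x x; set a := _ *m x => aN.
apply/matrixP => i j; rewrite !ord1 mxE; move/matrixP: aN => /(_ 0 0).
by rewrite !mxE => /eqP; rewrite eq_sym eqNr => /eqP.
Qed.

(** Since [2k < 2n], some [x <> 0] is symplectically orthogonal to the frame.
    The vector [J^T x] pairs with [x] to [|x|^2 > 0]; removing its component in
    the span of the frame keeps this pairing, and rescaling makes it [1]. *)
Lemma symplectic_frame_step n k (A B : 'M[R]_(n + n, k)) :
  (k < n)%N -> symplectic_frame A B ->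
  exists x y : 'cV[R]_(n + n), symplectic_frame (row_mx A x) (row_mx B y).
Proof.
move=> kn frAB; have := frAB; rewrite symplectic_frameP.
set U := row_mx A B => /SpStP UJU.
have [x x0 UJx] : exists2 x : 'cV[R]_(n + n), x != 0 & U^T *m J n *m x = 0.
  pose K := kermx (U^T *m J n)^T; have /rowV0Pn [v vK v0] : K != 0.
    rewrite kermx_eq0 /row_free neq_ltn (leq_ltn_trans (rank_leq_col _)) //.
    by rewrite addnn [X in (_ < X)%N]addnn ltn_double.
  exists v^T; first by rewrite -trmx0 (inj_eq trmx_inj).
  by apply: trmx_inj; rewrite trmx_mul trmxK trmx0; apply/sub_kermxP.
have xJU : x^T *m J n *m U = 0.
  by apply: oppr_inj; rewrite -symplectic_swap UJx trmx0 oppr0.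
(* [U *m sinv U] is the symplectic projector onto the span of the frame. *)
pose z := (J n)^T *m x; pose y0 := z - U *m sinv U *m z.
have UJy0 : U^T *m J n *m y0 = 0.
  by rewrite mulmxBr /sinv !mulmxA UJU mul_J_trJ mul1mx subrr.
have xJy0 : x^T *m J n *m y0 = x^T *m x.
  rewrite mulmxBr !mulmxA xJU !mul0mx subr0.
  by rewrite -[_ *m J n *m _]mulmxA mul_J_trJ mulmx1.
pose a := \tr (x^T *m x).
have a0 : a != 0 by apply: contra_neq x0 => /mxtrace_gram_eq0.
have xx : x^T *m x = a%:M by rewrite /a trace_mx11 -mx11_scalar.
pose y := a^-1 *: y0.
have UJy : U^T *m J n *m y = 0 by rewrite -scalemxAr UJy0 scaler0.
have xJy : x^T *m J n *m y = 1%:M.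
  by rewrite -scalemxAr xJy0 xx scale_scalar_mx mulVf.
have [AJA BJB AJB] := frAB.
move: UJx UJy; rewrite tr_row_mx !mul_col_mx.
rewrite -[X in _ = X -> _]col_mx0 -[X in _ -> _ = X -> _]col_mx0.
move=> /eq_col_mx [AJx BJx] /eq_col_mx [AJy BJy].
have swap l (C : 'M[R]_(n + n, l)) w : C^T *m J n *m w = 0 -> w^T *m J n *m C = 0.
  by move=> wC; apply: oppr_inj; rewrite -symplectic_swap wC trmx0 oppr0.
exists x, y; split; rewrite tr_row_mx mul_col_mx mul_col_row.
- by rewrite AJA AJx (swap _ _ _ _ AJx) symplectic_col_isotropic block_mx0.
- by rewrite BJB BJy (swap _ _ _ _ BJy) symplectic_col_isotropic block_mx0.
- by rewrite AJB AJy xJy (swap _ _ _ _ BJx) -scalar_mx_block.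
Qed.

(** The prefix condition is stated as a product with [pid_mx k], which avoids
    splitting [n] as [k + d] in the induction and is exactly what the projection
    [piSpSt] computes on each block of columns. *)
Lemma symplectic_frame_completion n k (A B : 'M[R]_(n + n, k)) :
  (k <= n)%N -> symplectic_frame A B ->
  exists A' B' : 'M[R]_(n + n, n),
    [/\ symplectic_frame A' B', A' *m pid_mx k = A & B' *m pid_mx k = B].
Proof.
move=> kn; have [d dE] : exists d, d = (n - k)%N by exists (n - k)%N.
elim: d k kn dE A B => [|d IH] k kn dE A B frAB.
  have nk : n = k by apply/eqP; rewrite eqn_leq kn -subn_eq0 -dE eqxx.
  by subst k; exists A, B; rewrite pid_mx_1 !mulmx1.
have ltkn : (k < n)%N by rewrite -subn_gt0 -dE.
have [x [y frxy]] := symplectic_frame_step ltkn frAB.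
have [||A' [B' [fr' A'E B'E]]] := IH (k + 1)%N _ _ _ _ frxy.
- by rewrite addn1.
- by rewrite addn1 subnS -dE.
have pidE : (pid_mx k : 'M[R]_(n, k)) =
    (pid_mx (k + 1) : 'M[R]_(n, k + 1)) *m pid_mx k.
  by rewrite mul_pid_mx (minn_idPr _) ?leq_addr// (minn_idPr _) ?leq_addr.
have takeE (C : 'M[R]_(n + n, k)) (w : 'cV_(n + n)) : row_mx C w *m pid_mx k = C.
  by rewrite pid_mx_col mul_row_col mulmx1 mulmx0 addr0.
exists A', B'; split=> //.
- by rewrite pidE mulmxA A'E takeE.
- by rewrite pidE mulmxA B'E takeE.
Qed.

Lemma piSpSt_surj n k (U : 'M[R]_(n + n, k + k)) : (k <= n)%N -> SpSt U ->
  exists2 M : 'M[R]_(n + n), Sp M & piSpSt k M = U.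
Proof.
move=> kn; rewrite -[U]hsubmxK => /symplectic_frameP frU.
have [A [B [frAB AE BE]]] := symplectic_frame_completion kn frU.
exists (row_mx A B); first exact/symplectic_frameP.
by rewrite /piSpSt /Emx mul_row_block !mulmx0 addr0 add0r AE BE.
Qed.

End Symplectic.

(** * Tangent vectors as symmetric matrices *)

Section Tangent.
Context {R : realType} {n : nat}.
Implicit Types (M X S : 'M[R]_(n + n)).
Local Notation J := (@Jmx R n).

(** The matrix is [S = J^T X M^-1 = M^-T (M^T J^T X) M^-1], congruent to the
    matrix whose symmetry expresses tangency. *)
Lemma tangent_SpP M X : Sp M ->
  tangent_Sp M X <-> exists2 S, S^T = S & X = J *m S *m M.
Proof.
move=> SpM; have [N MN NM] : exists2 N, M *m N = 1%:M & N *m M = 1%:M.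
  by exists (sinv M) => //; exact: Sp_mulmx_sinv.
rewrite -[tangent_Sp M X]/(tangent_SpSt M X) tangent_SpStP; split=> [symX|].
- exists (N^T *m (M^T *m J^T *m X) *m N).
    apply: tr_congruence.
    by rewrite trJmx mulmxN mulNmx linearN /= symX.
  have MsT : N^T *m M^T = 1%:M by rewrite -trmx_mul MN trmx1.
  rewrite !mulmxA -[J *m _ *m _]mulmxA MsT mulmx1 mul_J_trJ mul1mx.
  by rewrite -mulmxA NM mulmx1.
- move=> [S symS ->].
  have -> : M^T *m J *m (J *m S *m M) = - (M^T *m S *m M).
    by rewrite !mulmxA -[_ *m J *m J]mulmxA JmxJ mulmxN mulmx1 !mulNmx.
  by rewrite linearN /= tr_congruence.
Qed.

Lemma gSpE M S1 S2 : Sp M ->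
  gSp M (J *m S1 *m M) (J *m S2 *m M) = 2^-1 * \tr (S1^T *m S2).
Proof.
move=> SpM; rewrite /gSp -!(mulmxA _ M) (Sp_mulmx_sinv SpM) !mulmx1.
by rewrite trmx_mul mulmxA -(mulmxA _ J^T) mul_trJ_J mulmx1.
Qed.

Lemma diff_piSpSt k M X : 'd (@piSpSt R n k) M X = X *m Emx n k.
Proof.
rewrite (_ : @piSpSt R n k = mulmxr (Emx n k)) //.
by rewrite diff_lin //; exact: linear_mx_continuous.
Qed.

End Tangent.

(** * The horizontal lift and the metric *)

Section HorizontalLift.
Context {R : realType} {n k : nat}.
Implicit Types (M X S : 'M[R]_(n + n)) (U D W : 'M[R]_(n + n, k + k)).
Local Notation J := (@Jmx R n).

(** The symmetric solution [S] of [S U = W] of least Frobenius norm, when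
    [U^T W] is symmetric and the columns of [U] are independent. *)
Definition sym_lift U W : 'M[R]_(n + n) :=
  W *m invmx (U^T *m U) *m U^T +
  U *m invmx (U^T *m U) *m W^T *m (1%:M - U *m invmx (U^T *m U) *m U^T).

Definition metric_SpSt U D1 D2 : R :=
  \tr (D1^T *m
    (1%:M - 2^-1 *: (J^T *m U *m invmx (U^T *m U) *m U^T *m J))
    *m D2 *m invmx (U^T *m U)).

Lemma tr_invmx_gram U : (invmx (U^T *m U))^T = invmx (U^T *m U).
Proof. by rewrite trmx_inv trmx_mul trmxK. Qed.

Lemma projector_id U : SpSt U -> U *m invmx (U^T *m U) *m U^T *m U = U.
Proof. by move=> /SpSt_gram gU; rewrite -!mulmxA mulVmx ?mulmx1. Qed.

Lemma coprojector_mul U :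
  SpSt U -> (1%:M - U *m invmx (U^T *m U) *m U^T) *m U = 0.
Proof. by move=> SU; rewrite mulmxBl mul1mx projector_id ?subrr. Qed.

Lemma sym_lift_sym U W : (U^T *m W)^T = U^T *m W -> (sym_lift U W)^T = sym_lift U W.
Proof.
rewrite trmx_mul trmxK => UW.
rewrite /sym_lift mulmxBr mulmx1; set G := invmx _.
have GT : G^T = G := tr_invmx_gram U.
have PA : U *m G *m W^T *m (U *m G *m U^T) = U *m G *m U^T *m (W *m G *m U^T).
  by rewrite !mulmxA -(mulmxA _ W^T) UW !mulmxA.
rewrite linearD linearB /= [in LHS]PA !trmx_mul !trmxK GT PA !mulmxA addrCA.
by rewrite -!mulmxA [W^T *m (U *m _)]mulmxA UW -!mulmxA.
Qed.

Lemma sym_lift_mul U W : SpSt U -> sym_lift U W *m U = W.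
Proof.
move=> SU; rewrite /sym_lift mulmxDl -(mulmxA _ (_ - _)) coprojector_mul //.
by rewrite mulmx0 addr0 -!mulmxA mulVmx ?mulmx1 //; exact: SpSt_gram.
Qed.

(** Both terms of [sym_lift] have a factor that [S] kills: [U^T] on the right of
    the first, and [U] on the left of the second after a cyclic permutation. *)
Lemma sym_lift_orthogonal U W S : S^T = S -> S *m U = 0 ->
  (U^T *m W)^T = U^T *m W -> \tr ((sym_lift U W)^T *m S) = 0.
Proof.
move=> symS SU UW; have US : U^T *m S = 0.
  by apply: trmx_inj; rewrite trmx_mul trmxK symS SU trmx0.
rewrite sym_lift_sym // /sym_lift mulmxDl -(mulmxA _ U^T) US mulmx0 add0r.
by rewrite -!mulmxA mxtrace_mulC -!mulmxA SU !mulmx0 linear0.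
Qed.

(** With [S1], [S2] the two lifts, split [S1] into its two terms.  The first
    meets [U^T S2 = (S2 U)^T = W2^T] and contributes [tr (W1^T W2 G)]; the second
    contains [1 - P], which kills the second term of [S2], and contributes
    [tr (W1^T (1 - P) W2 G)].  Half the sum is the claim. *)
Lemma mxtrace_sym_lift U W1 W2 : SpSt U ->
  (U^T *m W1)^T = U^T *m W1 -> (U^T *m W2)^T = U^T *m W2 ->
  2^-1 * \tr ((sym_lift U W1)^T *m sym_lift U W2) =
  \tr (W1^T *m (1%:M - 2^-1 *: (U *m invmx (U^T *m U) *m U^T)) *m W2
       *m invmx (U^T *m U)).
Proof.
move=> SU UW1 UW2; rewrite sym_lift_sym // [sym_lift U W1]/sym_lift mulmxDl.
set G := invmx _; set P := U *m G *m U^T; set S2 := sym_lift U W2.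
have GT : G^T = G := tr_invmx_gram U.
have UTS2 : U^T *m S2 = W2^T.
  by apply: trmx_inj; rewrite trmx_mul !trmxK sym_lift_sym // sym_lift_mul.
have PS2 : (1%:M - P) *m S2 = (1%:M - P) *m W2 *m G *m U^T.
  by rewrite mulmxDr !mulmxA coprojector_mul // !mul0mx addr0.
rewrite -(mulmxA _ U^T) UTS2 -(mulmxA _ (1%:M - P)) PS2 linearD /=.
have -> : \tr (W1 *m G *m W2^T) = \tr (W1^T *m W2 *m G).
  by rewrite -mxtrace_tr !trmx_mul trmxK GT mulmxA mxtrace_mulC mulmxA.
have -> : \tr (U *m G *m W1^T *m ((1%:M - P) *m W2 *m G *m U^T)) =
    \tr (W1^T *m (1%:M - P) *m W2 *m G).
  rewrite mulmxA mxtrace_mulC -!mulmxA [U^T *m _]mulmxA.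
  rewrite [U^T *m U *m _]mulmxA mulmxV ?mul1mx //.
  exact: SpSt_gram.
rewrite !mulmxBr !mulmxBl !mulmx1 !linearB /= -scalemxAr -!scalemxAl linearZ /=.
set t := \tr (W1^T *m W2 *m G).
by rewrite addrA -mulr2n -(mulr_natl t 2) mulrBr mulrA mulVf ?mul1r // pnatr_eq0.
Qed.

Lemma tangent_SpSt_sym U D : tangent_SpSt U D ->
  (U^T *m (J^T *m D))^T = U^T *m (J^T *m D).
Proof.
by move=> /tangent_SpStP UD; rewrite mulmxA trJmx mulmxN mulNmx linearN /= UD.
Qed.

Lemma metric_SpStE U D1 D2 : SpSt U ->
  tangent_SpSt U D1 -> tangent_SpSt U D2 ->
  metric_SpSt U D1 D2 =
  2^-1 * \tr ((sym_lift U (J^T *m D1))^T *m sym_lift U (J^T *m D2)).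
Proof.
move=> SU /tangent_SpSt_sym TD1 /tangent_SpSt_sym TD2.
rewrite mxtrace_sym_lift // /metric_SpSt trmx_mul trmxK; congr (\tr (_ *m _)).
rewrite -!mulmxA; congr (_ *m _); rewrite !mulmxA; congr (_ *m _).
rewrite mulmxBr mulmxBl mulmx1 mul_J_trJ -scalemxAr -scalemxAl; congr (_ - _ *: _).
by rewrite !mulmxA trJmx mulmxN !mulNmx.
Qed.

Lemma metric_SpSt_sym U D1 D2 : SpSt U ->
  tangent_SpSt U D1 -> tangent_SpSt U D2 ->
  metric_SpSt U D1 D2 = metric_SpSt U D2 D1.
Proof.
move=> SU T1 T2; rewrite !metric_SpStE //.
by rewrite -mxtrace_tr trmx_mul trmxK.
Qed.

(** Half a Frobenius square, which vanishes only if [sym_lift U W] does, and then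
    so does [W = sym_lift U W U]. *)
Lemma metric_SpSt_gt0 U D : SpSt U -> tangent_SpSt U D -> D != 0 ->
  0 < metric_SpSt U D D.
Proof.
move=> SU TD D0; rewrite metric_SpStE // mulr_gt0 // ?invr_gt0 //.
rewrite lt0r mxtrace_gram_ge0 andbT; apply: contra_neq D0 => /mxtrace_gram_eq0 L0.
have : J *m (sym_lift U (J^T *m D) *m U) = 0 by rewrite L0 mul0mx mulmx0.
by rewrite sym_lift_mul // mulmxA mul_J_trJ mul1mx.
Qed.

Definition horizontal_lift M D : 'M[R]_(n + n) :=
  J *m sym_lift (piSpSt k M) (J^T *m D) *m M.

Lemma piSpSt_SpSt M : (k <= n)%N -> Sp M -> SpSt (piSpSt k M).
Proof. by move=> kn SM; apply: mul_SpSt => //; exact: Emx_SpSt. Qed.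

Lemma lift_horizontal M D : (k <= n)%N -> Sp M -> tangent_SpSt (piSpSt k M) D ->
  horizontal tangent_Sp gSp (@piSpSt R n k) M (horizontal_lift M D).
Proof.
move=> kn SM /tangent_SpSt_sym TD; split.
  by apply/tangent_SpP => //; exists (sym_lift (piSpSt k M) (J^T *m D));
    first exact: sym_lift_sym.
move=> Y /(tangent_SpP _ SM) [S symS ->]; rewrite diff_piSpSt => SE.
rewrite gSpE // sym_lift_orthogonal ?mulr0 //.
rewrite -!mulmxA in SE.
by rewrite -[S]mul1mx -mul_trJ_J -!mulmxA SE mulmx0.
Qed.

Lemma diff_lift M D : (k <= n)%N -> Sp M ->
  'd (@piSpSt R n k) M (horizontal_lift M D) = D.
Proof.
move=> kn SM; rewrite diff_piSpSt -mulmxA -/(piSpSt k M) /horizontal_lift.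
rewrite -mulmxA sym_lift_mul; last exact: piSpSt_SpSt.
by rewrite mulmxA mul_J_trJ mul1mx.
Qed.

(** The difference of the two vectors is vertical, hence orthogonal to both of
    them, hence to itself. *)
Lemma horizontal_inj M X Y : Sp M ->
  horizontal tangent_Sp gSp (@piSpSt R n k) M X ->
  horizontal tangent_Sp gSp (@piSpSt R n k) M Y ->
  'd (@piSpSt R n k) M X = 'd (@piSpSt R n k) M Y -> X = Y.
Proof.
move=> SM [/(tangent_SpP _ SM) [S symS ->] hX].
move=> [/(tangent_SpP _ SM) [S' symS' ->] hY].
set Z := J *m (S - S') *m M => dXY.
have TZ : tangent_Sp M Z.
  by apply/tangent_SpP => //; exists (S - S') => //; rewrite linearB /= symS symS'.
have dZ : 'd (@piSpSt R n k) M Z = 0.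
  by rewrite /Z mulmxBr mulmxBl linearB /= dXY subrr.
have := hX _ TZ dZ; have := hY _ TZ dZ; rewrite !gSpE // => S'0 S0.
have /eqP : 2^-1 * \tr ((S - S')^T *m (S - S')) = 0.
  by rewrite [(S - S')^T]linearB /= mulmxBl linearB /= mulrBr S0 S'0 subrr.
rewrite mulf_eq0 invr_eq0 pnatr_eq0 /= => /eqP /mxtrace_gram_eq0 /eqP.
by rewrite subr_eq0 => /eqP ->.
Qed.

Lemma hor_lift_SpE M D : (k <= n)%N -> Sp M -> tangent_SpSt (piSpSt k M) D ->
  hor_lift_Sp M D = horizontal_lift M D.
Proof.
move=> kn SM TD; apply: xget_unique.
  by split; [exact: lift_horizontal|exact: diff_lift].
move=> X [hX dX]; apply: (horizontal_inj SM) => //; first exact: lift_horizontal.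
by rewrite diff_lift.
Qed.

Lemma gSp_lift M D1 D2 : (k <= n)%N -> Sp M ->
  tangent_SpSt (piSpSt k M) D1 -> tangent_SpSt (piSpSt k M) D2 ->
  gSp M (horizontal_lift M D1) (horizontal_lift M D2) =
  metric_SpSt (piSpSt k M) D1 D2.
Proof.
by move=> kn SM T1 T2; rewrite gSpE // metric_SpStE //; exact: piSpSt_SpSt.
Qed.

Lemma diff_piSpSt_tangent M X : Sp M -> tangent_Sp M X ->
  tangent_SpSt (piSpSt k M) ('d (@piSpSt R n k) M X).
Proof.
move=> SM /(tangent_SpP _ SM) [S symS ->]; apply/tangent_SpStP.
rewrite diff_piSpSt -(mulmxA _ M) -/(piSpSt k M); set U := piSpSt k M.
have -> : U^T *m J *m (J *m S *m U) = - (U^T *m S *m U).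
  by rewrite !mulmxA -[_ *m J *m J]mulmxA JmxJ mulmxN mulmx1 !mulNmx.
by rewrite linearN /= tr_congruence.
Qed.

(** Local smooth extensions of the two vector fields give one of the formula, on
    the part of their common domain where [U^T U] is invertible; this part is
    open because the determinant is continuous. *)
Lemma metric_SpSt_smooth (X Y : 'M[R]_(n + n, k + k) -> 'M[R]_(n + n, k + k)) :
  smooth_on (@SpSt R n k) X -> smooth_on (@SpSt R n k) Y ->
  smooth_on (@SpSt R n k) (fun U => metric_SpSt U (X U) (Y U) : R).
Proof.
move=> sX sY U SU.
have [ O1 [F1 [oO1 O1U F1C F1X]]] := sX U SU.
have [ O2 [F2 [oO2 O2U F2C F2Y]]] := sY U SU.
pose O3 := [set V : 'M[R]_(n + n, k + k) | \det (V^T *m V) != 0].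
have idC r O : open O -> entries_C_on r O (fun V : 'M[R]_(n + n, k + k) => V).
  move=> oO i j; apply: (C_on_coord i j oO).
  exact: (@C_on_linear _ _ _ r O idfun (fun x => cvg_id)).
have detC r O : open O -> C_on r O (fun V : 'M[R]_(n + n, k + k) => \det (V^T *m V)).
  move=> oO; apply: C_on_det => //; apply: entries_C_onM => //; last exact: idC.
  by apply: entries_C_on_tr; exact: idC.
have oO3 : open O3.
  apply: (@open_comp _ _ (fun V : 'M[R]_(n + n, k + k) => \det (V^T *m V))
    [set x | x != 0]).
    by move=> V _; apply: (C_on_continuous (detC 0%N setT openT)).
  exact: open_neq.
exists (O1 `&` O2 `&` O3), (fun V => metric_SpSt V (F1 V) (F2 V)); split.
- by apply: openI => //; exact: openI.
- by split=> //; rewrite /O3 /= -unitfE -unitmxE; exact: SpSt_gram.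
- move=> r; set O := O1 `&` O2 `&` O3.
  have oO : open O by apply: openI => //; exact: openI.
  have F1O : entries_C_on r O F1.
    move=> i j; apply: C_on_coord => //; apply: C_on_subset (F1C r).
    by move=> V [[]].
  have F2O : entries_C_on r O F2.
    move=> i j; apply: C_on_coord => //; apply: C_on_subset (F2C r).
    by move=> V [[]].
  have UC := idC r O oO; have UTC := entries_C_on_tr UC.
  have GC : entries_C_on r O (fun V : 'M[R]_(n + n, k + k) => invmx (V^T *m V)).
    apply: entries_C_onV => //; last exact: entries_C_onM.
    by move=> V [_ O3V]; rewrite unitmxE unitfE.
  have cC p q (A : 'M[R]_(p, q)) := @entries_C_on_cst _ 'M[R]_(n + n, k + k) r O p q A.
  apply: C_on_mxtrace => //; apply: entries_C_onM => //; apply: entries_C_onM => //.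
  apply: entries_C_onM => //; first exact: entries_C_on_tr.
  have -> : (fun V : 'M[R]_(n + n, k + k) =>
        1%:M - 2^-1 *: (J^T *m V *m invmx (V^T *m V) *m V^T *m J)) =
      (fun V => 1%:M + (- 2^-1) *: (J^T *m V *m invmx (V^T *m V) *m V^T *m J)).
    by apply/funext => V; rewrite scaleNr.
  apply: entries_C_onD => //; apply: entries_C_onZ => //; first exact: C_on_cst.
  by do !apply: entries_C_onM => //.
- by move=> V [[ O1V O2V] _] SV; rewrite F1X // F2Y.
Qed.

Lemma metric_SpSt_riemannian :
  riemannian_metric (@SpSt R n k) tangent_SpSt metric_SpSt.
Proof.
split.
- move=> U _ a D1 D2 D _ _ _; rewrite /metric_SpSt.
  set Q := 1%:M - _; rewrite [(_ + _)^T]linearP /=.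
  by rewrite !mulmxDl -!scalemxAl linearD linearZ.
- by move=> U SU D1 D2; exact: metric_SpSt_sym.
- by move=> U SU D; exact: metric_SpSt_gt0.
- by move=> X Y _ _; exact: metric_SpSt_smooth.
Qed.

Lemma piSpSt_submersion : (k <= n)%N ->
  riemannian_submersion (@Sp R n) tangent_Sp gSp
    (@SpSt R n k) tangent_SpSt metric_SpSt (@piSpSt R n k).
Proof.
move=> kn; split.
- apply/seteqP; split=> [_ [M SM <-]|U SU]; first exact: piSpSt_SpSt.
  by have [M SM MU] := piSpSt_surj kn SU; exists M.
- have piC : continuous (mulmxr (@Emx R n k) : 'M[R]_(n + n) -> _).
    exact: linear_mx_continuous.
  split=> [M _|M _]; last exact: (linear_differentiable _ piC).
  exists setT, (@piSpSt R n k); split=> //; first exact: openT.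
  by move=> r; exact: C_on_linear piC.
- move=> M SM; apply/seteqP; split=> [_ [X TX <-]|D TD].
    exact: diff_piSpSt_tangent.
  by exists (horizontal_lift M D); [case: (lift_horizontal kn SM TD)|exact: diff_lift].
- move=> M SM X Y hX hY.
  have TX := diff_piSpSt_tangent SM hX.1; have TY := diff_piSpSt_tangent SM hY.1.
  have liftE Z : horizontal tangent_Sp gSp (@piSpSt R n k) M Z ->
      horizontal_lift M ('d (@piSpSt R n k) M Z) = Z.
    move=> hZ; apply: (horizontal_inj SM _ hZ); last by rewrite diff_lift.
    by apply: lift_horizontal => //; exact: diff_piSpSt_tangent SM hZ.1.
  by rewrite -gSp_lift // !liftE.
Qed.

(** The isometry condition applied to the two horizontal lifts leaves no choice
    for the metric downstairs. *)
Lemma submersion_metric_unique h M D1 D2 : (k <= n)%N ->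
  riemannian_submersion (@Sp R n) tangent_Sp gSp
    (@SpSt R n k) tangent_SpSt h (@piSpSt R n k) ->
  Sp M -> tangent_SpSt (piSpSt k M) D1 -> tangent_SpSt (piSpSt k M) D2 ->
  h (piSpSt k M) D1 D2 = gSp M (horizontal_lift M D1) (horizontal_lift M D2).
Proof.
move=> kn [_ _ _ iso] SM T1 T2.
rewrite -iso //; [|exact: lift_horizontal..].
by rewrite !diff_lift.
Qed.

Lemma tangent_mul_Sp U D (N : 'M[R]_(k + k)) :
  tangent_SpSt U D -> tangent_SpSt (U *m N) (D *m N).
Proof.
move=> /tangent_SpStP UD; apply/tangent_SpStP.
have -> : (U *m N)^T *m J *m (D *m N) = N^T *m (U^T *m J *m D) *m N.
  by rewrite trmx_mul !mulmxA.
exact: tr_congruence.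
Qed.

(** The Gram inverse becomes [N^-1 G N^-T], so [U G U^T] is unchanged and the
    remaining factors [N] cancel under the trace. *)
Lemma metric_SpSt_mul_Sp U D1 D2 (N : 'M[R]_(k + k)) : SpSt U -> Sp N ->
  metric_SpSt (U *m N) (D1 *m N) (D2 *m N) = metric_SpSt U D1 D2.
Proof.
move=> SU SN; have gU := SpSt_gram SU.
have NN : sinv N *m N = 1%:M := SN; have NN' := mulmx1C NN.
have uN : N \in unitmx by case/mulmx1_unit: NN.
have GN : invmx ((U *m N)^T *m (U *m N)) =
    invmx N *m invmx (U^T *m U) *m (invmx N)^T.
  have -> : (U *m N)^T *m (U *m N) = N^T *m (U^T *m U) *m N.
    by rewrite trmx_mul !mulmxA.
  by rewrite !invmx_mul ?unitmx_mul ?unitmx_tr ?uN ?gU // trmx_inv mulmxA.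
have NTN : (invmx N)^T *m N^T = 1%:M by rewrite -trmx_mul mulmxV ?trmx1.
rewrite /metric_SpSt GN.
have -> : J^T *m (U *m N) *m (invmx N *m invmx (U^T *m U) *m (invmx N)^T)
    *m (U *m N)^T *m J = J^T *m U *m invmx (U^T *m U) *m U^T *m J.
  rewrite trmx_mul !mulmxA -(mulmxA _ N (invmx N)) mulmxV // mulmx1.
  by rewrite -(mulmxA _ (invmx N)^T) NTN mulmx1.
rewrite !trmx_mul !mulmxA -(mulmxA _ N (invmx N)) mulmxV // mulmx1.
by rewrite mxtrace_mulC !mulmxA NTN mul1mx.
Qed.

End HorizontalLift.

Unset Implicit Arguments.

Theorem proposition3p10 (R : realType) (n k : nat)
    (hk : (0 < k)%N) (hkn : (k <= n)%N) :
  (exists h : 'M[R]_(n + n, k + k) -> 'M[R]_(n + n, k + k) ->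
              'M[R]_(n + n, k + k) -> R,
     riemannian_metric (@SpSt R n k) tangent_SpSt h /\
     riemannian_submersion (@Sp R n) tangent_Sp gSp
       (@SpSt R n k) tangent_SpSt h (@piSpSt R n k)) /\
  (forall h : 'M[R]_(n + n, k + k) -> 'M[R]_(n + n, k + k) ->
              'M[R]_(n + n, k + k) -> R,
     riemannian_metric (@SpSt R n k) tangent_SpSt h ->
     riemannian_submersion (@Sp R n) tangent_Sp gSp
       (@SpSt R n k) tangent_SpSt h (@piSpSt R n k) ->
     right_invariant h /\
     (forall (M : 'M[R]_(n + n)) (U D1 D2 : 'M[R]_(n + n, k + k)),
        Sp M -> U = piSpSt k M ->
        tangent_SpSt U D1 -> tangent_SpSt U D2 ->
        h U D1 D2 = gSp M (hor_lift_Sp M D1) (hor_lift_Sp M D2) /\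
        gSp M (hor_lift_Sp M D1) (hor_lift_Sp M D2) =
        \tr (D1^T *m
             (1%:M - 2^-1 *: ((Jmx n)^T *m U *m invmx (U^T *m U) *m U^T *m Jmx n))
             *m D2 *m invmx (U^T *m U)))).
Proof.
split.
  exists metric_SpSt; split; first exact: metric_SpSt_riemannian.
  exact: piSpSt_submersion.
move=> h _ subm.
have hE U D1 D2 : SpSt U -> tangent_SpSt U D1 -> tangent_SpSt U D2 ->
    h U D1 D2 = metric_SpSt U D1 D2.
  move=> /(piSpSt_surj hkn) [M SM <-] T1 T2.
  by rewrite (submersion_metric_unique hkn subm) // gSp_lift.
split=> [N U D1 D2 SN SU T1 T2 /=|M _ D1 D2 SM -> T1 T2].
  have dE D : 'd (fun U' : 'M[R]_(n + n, k + k) => U' *m N) U D = D *m N.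
    rewrite -[fun U' => _]/(mulmxr N : 'M[R]_(n + n, k + k) -> _).
    by rewrite diff_lin //; exact: linear_mx_continuous.
  rewrite !dE !hE // ?metric_SpSt_mul_Sp //; try exact: tangent_mul_Sp.
  exact: mul_SpSt.
by rewrite !hor_lift_SpE // (submersion_metric_unique hkn subm) // gSp_lift.
Qed.
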